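(* There is a set $A \subseteq \mathbb{N}$ that contains no arithmetic progression of length three and such that the ratio set $R(A) = \{a/a' : a,a' \in A\}$ is dense in $\mathbb{Q}_p$ for every prime $p$.
   Context: $\mathbb{N} = \{1,2,\ldots\}$; $\mathbb{Q}_p$ denotes the field of $p$-adic numbers with the $p$-adic metric. *)

(* Defs.v *)
From HB Require Import structures.
From mathcomp Require Import all_boot all_order all_algebra.
From mathcomp Require Import ring lra.
From mathcomp Require Import ring_quotient generic_quotient.
From mathcomp Require Import boolp classical_sets functions.
From mathcomp Require Import topology.

Set Implicit Arguments.
Unset Strict Implicit.
Unset Printing Implicit Defensive.

Import Order.TTheory GRing.Theory Num.Theory.

Local Open Scope classical_set_scope.
Local Open Scope ring_scope.
Local Open Scope quotient_scope.

(* [logn p] vanishes identically when [p] is not prime, so that [padic_abs p]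
   is then the trivial absolute value; this is why the construction below needs
   no primality hypothesis. *)
Definition padic_abs (p : nat) (x : rat) : rat :=
  if x == 0 then 0
  else p%:R ^ ((logn p `|denq x|)%:Z - (logn p `|numq x|)%:Z).

Section PadicAbs.
Variable p : nat.
Local Notation abs := (padic_abs p).

Let base_ge1 (n : nat) : (0 < logn p n)%N -> prime p.
Proof. by rewrite logn_gt0 mem_primes => /andP[]. Qed.

Lemma padic_abs0 : abs 0 = 0.
Proof. by rewrite /padic_abs eqxx. Qed.

Lemma padic_abs_nprime x : ~~ prime p -> abs x = (x != 0)%:R.
Proof.
move=> np; rewrite /padic_abs; case: eqP => //= _.
have l0 n : logn p n = 0%N.
  by apply/eqP; rewrite -leqn0 leqNgt; apply: contra np => /base_ge1.
by rewrite !l0 subrr expr0z.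
Qed.

Lemma padic_abs_gt0 x : x != 0 -> 0 < abs x.
Proof.
move=> x0; have [pp|np] := boolP (prime p).
  by rewrite /padic_abs (negPf x0) exprz_gt0 // ltr0n prime_gt0.
by rewrite padic_abs_nprime // x0.
Qed.

Lemma padic_abs_ge0 x : 0 <= abs x.
Proof.
have [->|x0] := eqVneq x 0; first by rewrite padic_abs0.
exact/ltW/padic_abs_gt0.
Qed.

Lemma padic_abs_eq0 x : (abs x == 0) = (x == 0).
Proof.
have [->|x0] := eqVneq x 0; first by rewrite padic_abs0 eqxx.
by rewrite gt_eqF // padic_abs_gt0.
Qed.

Lemma padic_abs_frac (a b : int) : a != 0 -> b != 0 ->
  abs (a%:~R / b%:~R) = p%:R ^ ((logn p `|b|)%:Z - (logn p `|a|)%:Z).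
Proof.
move=> a0 b0; set x : rat := a%:~R / b%:~R.
have x0 : x != 0 by rewrite mulf_neq0 ?invr_eq0 ?intr_eq0.
rewrite /padic_abs (negPf x0); congr (_ ^ _).
have E : (numq x * b)%R = (a * denq x)%R.
  apply/eqP; rewrite -(eqr_int rat) !rmorphM /= numqE /x.
  by rewrite -mulrA [_ * b%:~R]mulrC mulrA divfK ?intr_eq0.
have := congr1 (fun z : int => logn p `|z|) E; rewrite !abszM.
rewrite !lognM ?absz_gt0 ?numq_eq0 ?denq_eq0 // => H.
apply/eqP; rewrite subr_eq addrAC eq_sym subr_eq -!PoszD eqz_nat.
by rewrite [X in X == _]addnC H addnC.
Qed.

Lemma padic_absM x y : abs (x * y) = abs x * abs y.
Proof.
have [->|x0] := eqVneq x 0; first by rewrite mul0r padic_abs0 mul0r.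
have [->|y0] := eqVneq y 0; first by rewrite mulr0 padic_abs0 mulr0.
have [pp|np] := boolP (prime p); last first.
  by rewrite !padic_abs_nprime // mulf_neq0 // x0 y0 mulr1.
rewrite -{1}[x]divq_num_den -{1}[y]divq_num_den mulf_div -!intrM.
rewrite padic_abs_frac ?mulf_neq0 ?numq_eq0 ?denq_eq0 //.
rewrite /padic_abs (negPf x0) (negPf y0) -expfzDr; last first.
  by rewrite pnatr_eq0 -lt0n prime_gt0.
congr (_ ^ _).
rewrite !abszM !lognM ?absz_gt0 ?numq_eq0 ?denq_eq0 // !PoszD opprD.
by rewrite addrACA.
Qed.

Lemma padic_abs1 : abs 1 = 1.
Proof. by have := @padic_abs_frac 1 1 isT isT; rewrite divr1 subrr expr0z. Qed.

Lemma padic_absN x : abs (- x) = abs x.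
Proof. by rewrite /padic_abs oppr_eq0 numqN denqN abszN. Qed.

Lemma padic_absB x y : abs (x - y) = abs (y - x).
Proof. by rewrite -padic_absN opprB. Qed.

Lemma padic_absV x : abs (x^-1) = (abs x)^-1.
Proof.
have [->|x0] := eqVneq x 0; first by rewrite invr0 padic_abs0 ?invr0.
have := padic_absM x x^-1; rewrite divff // padic_abs1 => /esym E.
by apply: (mulfI (x := abs x)); rewrite ?E ?divff ?padic_abs_eq0.
Qed.

Lemma padic_absD x y : abs (x + y) <= Num.max (abs x) (abs y).
Proof.
have [->|x0] := eqVneq x 0.
  by rewrite add0r padic_abs0 max_r ?padic_abs_ge0.
have [->|y0] := eqVneq y 0.
  by rewrite addr0 padic_abs0 max_l ?padic_abs_ge0.
have [xy0|xy0] := eqVneq (x + y) 0.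
  by rewrite xy0 padic_abs0 le_max padic_abs_ge0.
have [pp|np] := boolP (prime p); last first.
  by rewrite !padic_abs_nprime // x0 y0 xy0 le_max lexx.
pose d := denq x * denq y; pose a := numq x * denq y; pose b := numq y * denq x.
have d0 : d != 0 by rewrite mulf_neq0 ?denq_eq0.
have a0 : a != 0 by rewrite mulf_neq0 ?denq_eq0 ?numq_eq0.
have b0 : b != 0 by rewrite mulf_neq0 ?denq_eq0 ?numq_eq0.
have nz z : (denq z)%:~R != 0 :> rat by rewrite intr_eq0 denq_eq0.
have xE : x = a%:~R / d%:~R.
  by rewrite /a /d !intrM -mulf_div divff ?nz // mulr1 divq_num_den.
have yE : y = b%:~R / d%:~R.
  by rewrite /b /d !intrM [X in _ / X]mulrC -mulf_div divff ?nz // mulr1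
    divq_num_den.
have xyE : x + y = (a + b)%:~R / d%:~R by rewrite intrD mulrDl -xE -yE.
have ab0 : a + b != 0.
  by apply: contraNneq xy0 => ab0; rewrite xyE ab0 mul0r.
rewrite xyE xE yE !padic_abs_frac // le_max.
have p1 : 1 < p%:R :> rat by rewrite ltr1n prime_gt1.
rewrite !ler_eXz2l // !lerD2l !lerN2 !lez_nat.
rewrite -!pfactor_dvdn ?absz_gt0 //.
have dv (k : nat) (z : int) : (p ^ k %| `|z|)%N = ((p ^ k)%N %| z)%Z by [].
case: (leqP (logn p `|a|) (logn p `|b|)) => [le|/ltnW le]; apply/orP;
  [left|right]; rewrite dv rpredD // -dv;
  by [apply: pfactor_dvdnn | rewrite pfactor_dvdn ?absz_gt0].
Qed.

Lemma padic_absD_lt x y e : abs x < e -> abs y < e -> abs (x + y) < e.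
Proof. by move=> xe ye; apply: le_lt_trans (padic_absD x y) _; rewrite gt_max xe. Qed.

Lemma padic_absD_eq x y : abs x < abs y -> abs (x + y) = abs y.
Proof.
move=> xy; apply/eqP; rewrite eq_le; apply/andP; split.
  by rewrite (le_trans (padic_absD _ _)) // ge_max lexx ltW.
have := padic_absD (- x) (x + y); rewrite addKr padic_absN le_max.
by rewrite leNgt xy.
Qed.

Lemma padic_abs_triangle x y : abs (x + y) <= abs x + abs y.
Proof.
apply: le_trans (padic_absD x y) _.
by rewrite ge_max lerDl lerDr !padic_abs_ge0.
Qed.

Lemma padic_abs_dist x y : `| abs x - abs y | <= abs (x - y).
Proof.
have := padic_abs_triangle (x - y) y; have := padic_abs_triangle (y - x) x.
rewrite !subrK (padic_absB y) ler_norml; lra.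
Qed.

End PadicAbs.

Definition padic_cauchy (p : nat) (u : nat -> rat) : Prop :=
  forall e : rat, 0 < e -> exists N : nat,
    forall m n : nat, (N <= m)%N -> (N <= n)%N -> padic_abs p (u m - u n) < e.

Definition padic_null (p : nat) (u : nat -> rat) : Prop :=
  forall e : rat, 0 < e -> exists N : nat,
    forall n : nat, (N <= n)%N -> padic_abs p (u n) < e.

Definition padic_cauchyb (p : nat) : pred (nat -> rat) :=
  fun u => `[< padic_cauchy p u >].

Section CauchySequences.
Variable p : nat.
Local Notation abs := (padic_abs p).

Lemma padic_cauchy_bounded u : padic_cauchy p u ->
  exists2 B : rat, 0 < B & exists N : nat, forall n, (N <= n)%N -> abs (u n) < B.
Proof.
move=> /(_ 1 ltr01)[N uN]; exists (abs (u N) + 1 + 1).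
  by rewrite -addrA ltr_wpDl ?padic_abs_ge0.
exists N => n Nn; rewrite -[u n](subrK (u N)); apply: padic_absD_lt.
  by apply: lt_le_trans (uN _ _ Nn (leqnn _)) _; rewrite lerDr addr_ge0 ?padic_abs_ge0.
by rewrite -addrA ltrDl.
Qed.

Lemma padic_cauchy_nonnull u : padic_cauchy p u -> ~ padic_null p u ->
  exists2 c : rat, 0 < c & exists N : nat, forall n, (N <= n)%N -> abs (u n) = c.
Proof.
move=> cu /existsNP[e /not_implyP[e0 /forallNP nu]].
have [N uN] := cu _ e0.
have /existsNP[m /not_implyP[Nm /negP]] := nu N; rewrite -leNgt => em.
exists (abs (u m)); first exact: lt_le_trans em.
exists N => n Nn; rewrite -[u n](subrK (u m)) padic_absD_eq //.
exact: lt_le_trans (uN _ _ Nn Nm) em.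
Qed.

Lemma padic_null_cauchy u : padic_null p u -> padic_cauchy p u.
Proof.
move=> nu e /nu[N uN]; exists N => m n Nm Nn.
by apply: padic_absD_lt; rewrite ?padic_absN uN.
Qed.

Lemma padic_cauchy_cst (x : rat) : padic_cauchy p (cst x).
Proof. by move=> e e0; exists 0%N => m n _ _; rewrite subrr padic_abs0. Qed.

Lemma padic_cauchyB u v :
  padic_cauchy p u -> padic_cauchy p v -> padic_cauchy p (u - v).
Proof.
move=> cu cv e e0; have [N uN] := cu _ e0; have [M vM] := cv _ e0.
exists (maxn N M) => m n; rewrite !geq_max => /andP[Nm Mm] /andP[Nn Mn].
rewrite [X in abs X](_ : _ = (u m - u n) + - (v m - v n)).
  by apply: padic_absD_lt; rewrite ?padic_absN ?uN ?vM.
have E (a b c d : rat) : a - c - (b - d) = (a - b) + - (c - d) by ring.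
exact: E.
Qed.

Lemma padic_nullM u v :
  padic_cauchy p u -> padic_null p v -> padic_null p (u * v).
Proof.
move=> /padic_cauchy_bounded[B B0 [N uN]] nv e e0.
have [M vM] := nv (e / B) (divr_gt0 e0 B0).
exists (maxn N M) => n; rewrite geq_max => /andP[Nn Mn].
rewrite [(u * v) n]/(u n * v n) padic_absM -(divfK (lt0r_neq0 B0) e) mulrC.
by rewrite ltr_pM ?padic_abs_ge0 ?uN ?vM.
Qed.

Lemma padic_cauchyM u v :
  padic_cauchy p u -> padic_cauchy p v -> padic_cauchy p (u * v).
Proof.
move=> cu cv e e0.
have [B B0 [N uN]] := padic_cauchy_bounded cu.
have [C C0 [M vM]] := padic_cauchy_bounded cv.
have [N' uN'] := cu _ (divr_gt0 e0 C0); have [M' vM'] := cv _ (divr_gt0 e0 B0).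
exists (maxn (maxn N M) (maxn N' M')) => m n; rewrite !geq_max.
move=> /andP[/andP[a1 a2] /andP[a3 a4]] /andP[/andP[b1 b2] /andP[b3 b4]].
rewrite [X in abs X](_ : _ = u m * (v m - v n) + (u m - u n) * v n); last first.
  by rewrite mulrBr mulrBl addrA subrK.
apply: padic_absD_lt; rewrite padic_absM.
  by rewrite -(divfK (lt0r_neq0 B0) e) mulrC ltr_pM ?padic_abs_ge0 ?uN ?vM'.
by rewrite -(divfK (lt0r_neq0 C0) e) ltr_pM ?padic_abs_ge0 ?uN' ?vM.
Qed.

Lemma padic_cauchyV u : padic_cauchy p u -> ~ padic_null p u ->
  padic_cauchy p (fun n => (u n)^-1).
Proof.
move=> cu /(padic_cauchy_nonnull cu)[c c0 [N uN]] e e0.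
have [M uM] := cu _ (mulr_gt0 (mulr_gt0 c0 c0) e0).
exists (maxn N M) => m n; rewrite !geq_max => /andP[Nm Mm] /andP[Nn Mn].
have nz k : (N <= k)%N -> u k != 0.
  by move=> /uN uk; rewrite -(padic_abs_eq0 p) uk gt_eqF.
have -> : (u m)^-1 - (u n)^-1 = (u m)^-1 * (u n)^-1 * (u n - u m).
  rewrite mulrBr mulfVK ?nz // mulrAC mulVf ?nz // mul1r //.
rewrite !padic_absM !padic_absV (uN m) // (uN n) //.
by rewrite -invfM mulrC ltr_pdivrMr ?mulr_gt0 // mulrC uM.
Qed.

Lemma padic_cauchyb_subring_closed : subring_closed (padic_cauchyb p).
Proof.
split=> [|u v|u v].
- exact/asboolP/padic_cauchy_cst.
- by move=> /asboolP cu /asboolP cv; apply/asboolP/padic_cauchyB.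
- by move=> /asboolP cu /asboolP cv; apply/asboolP/padic_cauchyM.
Qed.

HB.instance Definition _ :=
  GRing.isSubringClosed.Build (nat -> rat) (padic_cauchyb p)
    padic_cauchyb_subring_closed.

Record padic_seq : Type := PadicSeq {
  padic_seq_val :> nat -> rat;
  _ : padic_seq_val \in padic_cauchyb p }.

HB.instance Definition _ := [isSub for padic_seq_val].
HB.instance Definition _ := [Choice of padic_seq by <:].
HB.instance Definition _ := [SubChoice_isSubComNzRing of padic_seq by <:].

Lemma padic_seqP (u : padic_seq) : padic_cauchy p u.
Proof. exact/asboolP/(valP u). Qed.

Definition padic_null_ideal : pred padic_seq := fun u => `[< padic_null p u >].

Lemma padic_null_idealr_closed : idealr_closed padic_null_ideal.
Proof.
split=> [||a u v /asboolP nu /asboolP nv].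
- by apply/asboolP => e e0; exists 0%N => n _; rewrite padic_abs0.
- apply/negP => /asboolP /(_ 1 ltr01)[N /(_ N (leqnn _))].
  by rewrite [X in abs X](_ : _ = 1) // padic_abs1 ltxx.
- apply/asboolP => e e0.
  have [N aN] := padic_nullM (padic_seqP a) nu e0; have [M vM] := nv _ e0.
  exists (maxn N M) => n; rewrite geq_max => /andP[Nn Mn].
  exact: padic_absD_lt (aN _ Nn) (vM _ Mn).
Qed.

HB.instance Definition _ := isIdealr.Build padic_seq padic_null_ideal
  padic_null_idealr_closed.

(* The field of p-adic numbers: Cauchy sequences of rationals for the p-adic
   absolute value, modulo sequences converging to 0. *)
Definition Qp : Type := {ideal_quot (padic_null_ideal : idealr padic_seq)}.

HB.instance Definition _ := GRing.ComNzRing.on Qp.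
HB.instance Definition _ := EqQuotient.on Qp.

Lemma Qp_piD (u v : padic_seq) : \pi_Qp (u + v) = \pi_Qp u + \pi_Qp v.
Proof. exact: pi_addr. Qed.

Lemma Qp_piN (u : padic_seq) : \pi_Qp (- u) = - \pi_Qp u.
Proof. exact: pi_oppr. Qed.

Lemma Qp_piM (u v : padic_seq) : \pi_Qp (u * v) = \pi_Qp u * \pi_Qp v.
Proof. exact: pi_mulr. Qed.

Lemma Qp_pi0 : \pi_Qp (0 : padic_seq) = 0.
Proof. exact: pi_zeror. Qed.

Lemma Qp_pi1 : \pi_Qp (1 : padic_seq) = 1.
Proof. exact: pi_oner. Qed.

Lemma Qp_pi_eq (u v : padic_seq) :
  (\pi_Qp u == \pi_Qp v) = `[< padic_null p (u - v) >].
Proof. by rewrite piE. Qed.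

Lemma Qp_pi_eq0 (u : padic_seq) : (\pi_Qp u == 0) = `[< padic_null p u >].
Proof. by rewrite -Qp_pi0 Qp_pi_eq subr0. Qed.

(* The pointwise inverse of a Cauchy sequence is Cauchy as soon as the sequence
   is not null, which is the only case in which [insubd] is used. *)
Definition Qp_inv (x : Qp) : Qp :=
  if x == 0 then 0
  else \pi_Qp (insubd (0 : padic_seq) (fun n => (repr x n)^-1)).

Lemma Qp_mulVx (x : Qp) : x != 0 -> Qp_inv x * x = 1.
Proof.
move=> x0; rewrite /Qp_inv (negPf x0).
have nx : ~ padic_null p (repr x : padic_seq).
  by move=> /asboolP; rewrite -Qp_pi_eq0 reprK (negPf x0).
have cV := padic_cauchyV (padic_seqP (repr x)) nx.
rewrite -{2}[x]reprK -Qp_piM -Qp_pi1; apply/eqP; rewrite Qp_pi_eq.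
apply/asboolP => e e0.
have [c c0 [N xN]] := padic_cauchy_nonnull (padic_seqP (repr x)) nx.
exists N => n Nn.
rewrite [X in abs X](_ : _ = 0) ?padic_abs0 //.
rewrite [LHS](_ : _ = (insubd (0 : padic_seq) (fun n => (repr x n)^-1)) n
   * repr x n - 1) //.
rewrite [X in X n](_ : _ = fun n => (repr x n)^-1); last first.
  by rewrite [LHS]val_insubd ifT //; apply/asboolP.
by rewrite mulVf ?subrr // -(padic_abs_eq0 p) xN // gt_eqF.
Qed.

Lemma Qp_inv0 : Qp_inv 0 = 0.
Proof. by rewrite /Qp_inv eqxx. Qed.

HB.instance Definition _ := GRing.ComNzRing_isField.Build Qp Qp_mulVx Qp_inv0.

Definition rat_lim (s : nat -> rat) (r : rat) : Prop :=
  forall e : rat, 0 < e -> exists N : nat,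
    forall n : nat, (N <= n)%N -> `|s n - r| < e.

(* The p-adic absolute value of the class of (u_n) is lim |u_n|_p.  Absolute
   values of rationals are 0 or powers of p, a set that is discrete away from 0, so the
   limit is always a rational number (see [Qp_abs_lim]). *)
Definition Qp_abs (x : Qp) : rat :=
  xget 0 [set r | rat_lim (fun n => abs (repr x n)) r].

Lemma rat_lim_le s t a b : (forall n, s n <= t n) ->
  rat_lim s a -> rat_lim t b -> a <= b.
Proof.
move=> st sa tb; rewrite leNgt; apply/negP => ba.
have e0 : 0 < (a - b) / 2 by rewrite divr_gt0 ?subr_gt0.
have [N sN] := sa _ e0; have [M tM] := tb _ e0.
have := st (maxn N M).
have := sN _ (leq_maxl N M); have := tM _ (leq_maxr N M).
rewrite !ltr_norml; lra.
Qed.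

Lemma rat_lim_unique s a b : rat_lim s a -> rat_lim s b -> a = b.
Proof.
move=> sa sb; apply/eqP.
by rewrite eq_le (rat_lim_le _ sa sb) ?(rat_lim_le _ sb sa).
Qed.

Lemma rat_limD s t a b :
  rat_lim s a -> rat_lim t b -> rat_lim (fun n => s n + t n) (a + b).
Proof.
move=> sa tb e e0.
have e20 : 0 < e / 2 by rewrite divr_gt0.
have [N sN] := sa _ e20; have [M tM] := tb _ e20.
exists (maxn N M) => n; rewrite geq_max => /andP[/sN + /tM].
rewrite !ltr_norml; lra.
Qed.

Lemma rat_lim_eventually s a N :
  (forall n, (N <= n)%N -> s n = a) -> rat_lim s a.
Proof. by move=> sN e e0; exists N => n /sN->; rewrite subrr normr0. Qed.

Lemma Qp_abs_unique (u : padic_seq) r :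
  rat_lim (fun n => abs (u n)) r -> Qp_abs (\pi_Qp u) = r.
Proof.
move=> ur.
have : rat_lim (fun n => abs (repr (\pi_Qp u) n)) r.
  have /eqP := reprK (\pi_Qp u); rewrite Qp_pi_eq => /asboolP nu e e0.
  have e20 : 0 < e / 2 by rewrite divr_gt0.
  have [N uN] := ur _ e20; have [M nM] := nu _ e20.
  exists (maxn N M) => n; rewrite geq_max => /andP[/uN un /nM nn].
  have := le_lt_trans (padic_abs_dist p _ _) nn.
  move: un; rewrite !ltr_norml; lra.
rewrite /Qp_abs; set P := [set _ | _] => Pr.
exact: rat_lim_unique (xgetPex 0 (ex_intro P r Pr)) Pr.
Qed.

Lemma Qp_abs_lim (u : padic_seq) :
  rat_lim (fun n => abs (u n)) (Qp_abs (\pi_Qp u)).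
Proof.
suff [r ur] : exists r, rat_lim (fun n => abs (u n)) r.
  by rewrite (Qp_abs_unique ur).
have [nu|nu] := pselect (padic_null p u).
  exists 0 => e /nu[N uN]; exists N => n /uN.
  by rewrite subr0 ger0_norm // padic_abs_ge0.
have [c c0 [N uN]] := padic_cauchy_nonnull (padic_seqP u) nu.
by exists c; apply: (rat_lim_eventually uN).
Qed.

Lemma Qp_abs0 : Qp_abs 0 = 0.
Proof.
rewrite -Qp_pi0; apply: Qp_abs_unique.
by apply: (@rat_lim_eventually _ _ 0%N) => n _; exact: padic_abs0.
Qed.

Lemma Qp_abs_eq0 x : Qp_abs x = 0 -> x = 0.
Proof.
rewrite -[x]reprK => x0; apply/eqP; rewrite Qp_pi_eq0; apply/asboolP => e e0.
have [N xN] := Qp_abs_lim (repr x) e0; exists N => n /xN.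
by rewrite x0 subr0 ger0_norm // padic_abs_ge0.
Qed.

Lemma Qp_absN x : Qp_abs (- x) = Qp_abs x.
Proof.
rewrite -[x]reprK -Qp_piN; apply: Qp_abs_unique => e.
move=> /(Qp_abs_lim (repr x))[N xN]; exists N => n /xN.
by rewrite -padic_absN.
Qed.

Lemma Qp_abs_triangle x y : Qp_abs (x + y) <= Qp_abs x + Qp_abs y.
Proof.
rewrite -[x]reprK -[y]reprK -Qp_piD.
apply: rat_lim_le (Qp_abs_lim _) (rat_limD (Qp_abs_lim _) (Qp_abs_lim _)) => n.
exact: padic_abs_triangle.
Qed.

Definition Qp_dist (x y : Qp) : rat := Qp_abs (x - y).

Lemma Qp_distxx x : Qp_dist x x = 0.
Proof. by rewrite /Qp_dist subrr Qp_abs0. Qed.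

Lemma Qp_dist_positivity x y : Qp_dist x y = 0 -> x = y.
Proof. by move=> /Qp_abs_eq0/eqP; rewrite subr_eq0 => /eqP. Qed.

Lemma Qp_dist_sym x y : Qp_dist x y = Qp_dist y x.
Proof. by rewrite /Qp_dist -Qp_absN opprB. Qed.

Lemma Qp_dist_triangle y x z : Qp_dist x z <= Qp_dist x y + Qp_dist y z.
Proof. by rewrite /Qp_dist -[x - z](subrKA y) Qp_abs_triangle. Qed.

HB.instance Definition _ := @isMetric.Build rat Qp Qp_dist
  Qp_distxx Qp_dist_positivity Qp_dist_sym Qp_dist_triangle.

Lemma padic_cauchyb_cst (q : rat) : cst q \in padic_cauchyb p.
Proof. exact/asboolP/padic_cauchy_cst. Qed.

Definition rat_Qp (q : rat) : Qp := \pi_Qp (PadicSeq (padic_cauchyb_cst q)).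

Lemma rat_Qp_is_additive : zmod_morphism rat_Qp.
Proof.
move=> x y; rewrite /rat_Qp -Qp_piN -Qp_piD; congr (\pi_Qp _).
exact: val_inj.
Qed.

Lemma rat_Qp_is_multiplicative : monoid_morphism rat_Qp.
Proof.
split=> [|x y]; first by rewrite -Qp_pi1; congr (\pi_Qp _); exact: val_inj.
by rewrite /rat_Qp -Qp_piM; congr (\pi_Qp _); exact: val_inj.
Qed.

HB.instance Definition _ :=
  GRing.isZmodMorphism.Build rat Qp rat_Qp rat_Qp_is_additive.
HB.instance Definition _ :=
  GRing.isMonoidMorphism.Build rat Qp rat_Qp rat_Qp_is_multiplicative.

Lemma rat_QpE : rat_Qp =1 ratr.
Proof. by move=> q; rewrite -(fmorph_eq_rat rat_Qp). Qed.

Lemma Qp_abs_ratr (q : rat) : Qp_abs (ratr q) = abs q.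
Proof.
rewrite -rat_QpE; apply: Qp_abs_unique.
exact: (@rat_lim_eventually _ _ 0%N).
Qed.

Lemma Qp_dense_rat (x : Qp) (e : rat) :
  0 < e -> exists q : rat, Qp_dist x (ratr q) < e.
Proof.
move=> e0; have e20 : 0 < e / 2 by rewrite divr_gt0.
have [N xN] := padic_seqP (repr x) e20; exists (repr x N).
rewrite -rat_QpE /Qp_dist -{1}[x]reprK -Qp_piN -Qp_piD.
set u := (X in \pi_Qp X).
have [M uM] := Qp_abs_lim u e20.
have := uM _ (leq_maxr N M); have := xN _ _ (leq_maxl N M) (leqnn N).
rewrite -[repr x (maxn N M) - repr x N]/(u (maxn N M)) ltr_norml; lra.
Qed.

End CauchySequences.

Definition contains_AP (A : set nat) (k : nat) : Prop :=
  exists a d : nat, (0 < d)%N /\ forall i : nat, (i < k)%N -> A (a + i * d)%N.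

Definition ratio_set (F : fieldType) (A : set nat) : set F :=
  [set x | exists a a' : nat, [/\ A a, A a' & x = a%:R / a'%:R]].


Arguments ratio_set F A : clear implicits.

(* Main.v *)
Require Import Defs.
From mathcomp Require Import all_boot all_order all_algebra.
From mathcomp Require Import classical_sets topology.
From mathcomp Require Import zify.

Set Implicit Arguments.
Unset Strict Implicit.
Unset Printing Implicit Defensive.

Import Order.TTheory GRing.Theory Num.Theory.

Local Open Scope classical_set_scope.
Local Open Scope ring_scope.

(** A set of positive integers in which [x < y] forces [2 x <= y] contains no
    three-term progression.  Enumerate the rationals that are at least [2] and
    multiply the numerator and denominator of the [n]-th one by a factor that is
    at least twice everything used before: the resulting integers form such a
    set, and every rational [>= 2] is a ratio of two of them.  These rationals
    are dense in every [Qp p], since [q + p ^ n] tends to [q] p-adically while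
    it tends to infinity in [rat]. *)

Definition lacunary (k : nat) (A : set nat) : Prop :=
  forall x y : nat, A x -> A y -> (x < y)%N -> (k * x <= y)%N.

Lemma lacunary_AP_free (A : set nat) (m : nat) :
  A `<=` [set n | (0 < n)%N] -> lacunary 2 A -> (2 < m)%N ->
  ~ contains_AP A m.
Proof.
move=> A_gt0 lacA m_gt2 [a [d [d_gt0 AP]]].
have a_gt0 : (0 < a + 0 * d)%N by apply/A_gt0/AP; lia.
have: (2 * (a + 1 * d) <= a + 2 * d)%N by apply: lacA; [apply: AP..|]; lia.
lia.
Qed.

Lemma divq_absz_num_den (q : rat) :
  0 <= q -> `|numq q|%:R / `|denq q|%:R = q.
Proof.
move=> q_ge0.
by rewrite !natr_absz !ger0_norm ?denq_ge0 ?numq_ge0 ?divq_num_den.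
Qed.

Section LacunaryFractions.

Variables (k : nat) (q : nat -> rat).
Hypotheses (k_gt0 : (0 < k)%N) (q_ge : forall n, k%:R <= q n).

Let num (n : nat) : nat := `|numq (q n)|%N.
Let den (n : nat) : nat := `|denq (q n)|%N.

Fixpoint fraction_scale (n : nat) : nat :=
  if n is m.+1 then (k * (fraction_scale m * num m))%N else 1%N.

Local Notation scale := fraction_scale.

Definition scaled_fraction (n : nat) : set nat :=
  [set (scale n * den n)%N; (scale n * num n)%N].

Definition lacunary_fractions : set nat := \bigcup_n scaled_fraction n.

Let num_div_den n : (num n)%:R / (den n)%:R = q n.
Proof. exact/divq_absz_num_den/(le_trans (ler0n _ k)). Qed.

Let den_gt0 n : (0 < den n)%N.
Proof. by rewrite absz_gt0 denq_eq0. Qed.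

Let den_le_num n : (k * den n <= num n)%N.
Proof. by rewrite -(ler_nat rat) natrM -ler_pdivlMr ?ltr0n // num_div_den. Qed.

Let num_gt0 n : (0 < num n)%N.
Proof. by apply: leq_trans (den_le_num n); rewrite muln_gt0 k_gt0 den_gt0. Qed.

Lemma fraction_scale_gt0 n : (0 < scale n)%N.
Proof.
by elim: n => //= n scale_gt0; rewrite !muln_gt0 k_gt0 scale_gt0 num_gt0.
Qed.

Lemma fraction_scale_homo : {homo scale : m n / (m <= n)%N}.
Proof.
apply: homo_leq leq_trans _ => // n /=.
by rewrite mulnCA leq_pmulr // muln_gt0 k_gt0 num_gt0.
Qed.

Lemma scaled_fraction_bounds n x : scaled_fraction n x ->
  (scale n <= x)%N /\ (k * x <= scale n.+1)%N.
Proof.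
have den_le : (den n <= num n)%N.
  by apply: leq_trans (den_le_num n); rewrite leq_pmull.
by case=> -> /=; split; rewrite ?leq_pmulr // !leq_mul2l den_le !orbT.
Qed.

Lemma scaled_fraction_lacunary n : lacunary k (scaled_fraction n).
Proof. by move=> x y /= [] -> [] ->; have := den_le_num n; nia. Qed.

Lemma lacunary_fractions_gt0 : lacunary_fractions `<=` [set n | (0 < n)%N].
Proof.
move=> x [n _ /scaled_fraction_bounds[+ _]].
exact/leq_trans/fraction_scale_gt0.
Qed.

Lemma lacunary_fractionsP : lacunary k lacunary_fractions.
Proof.
move=> x y [m _ mx] [n _ ny] x_lt_y.
have [scale_le_x x_le_scale] := scaled_fraction_bounds mx.
have [scale_le_y y_le_scale] := scaled_fraction_bounds ny.
have [m_lt_n|n_lt_m|m_eq_n] := ltngtP m n.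
- apply: leq_trans x_le_scale (leq_trans _ scale_le_y).
  exact: fraction_scale_homo.
- have y_le_x : (k * y <= x)%N.
    apply: leq_trans y_le_scale (leq_trans _ scale_le_x).
    exact: fraction_scale_homo.
  have := leq_trans x_lt_y (leq_trans (leq_pmull y k_gt0) y_le_x).
  by rewrite ltnn.
- by move: mx; rewrite m_eq_n => nx; apply: (scaled_fraction_lacunary nx ny).
Qed.

Lemma ratio_set_lacunary_fractions :
  range q `<=` ratio_set rat lacunary_fractions.
Proof.
move=> _ [n _ <-]; exists (scale n * num n)%N, (scale n * den n)%N; split.
- by exists n => //; right.
- by exists n => //; left.
have scale_neq0 : (scale n)%:R != 0 :> rat.
  by rewrite pnatr_eq0 -lt0n fraction_scale_gt0.
by rewrite !natrM -mulf_div divff // mul1r num_div_den.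
Qed.

End LacunaryFractions.

Lemma exists_lacunary_ratio_ge (k : nat) : (0 < k)%N ->
  exists A : set nat,
    [/\ A `<=` [set n | (0 < n)%N],
        lacunary k A
      & [set q | k%:R <= q] `<=` ratio_set rat A].
Proof.
move=> k_gt0; pose q n : rat := Num.max (k%:R : rat) (odflt 0 (unpickle n)).
have q_ge n : k%:R <= q n by rewrite le_max lexx.
exists (lacunary_fractions k q); split.
- exact: lacunary_fractions_gt0.
- exact: lacunary_fractionsP.
- move=> r /= r_ge; apply: ratio_set_lacunary_fractions => //.
  by exists (pickle r) => //; rewrite /q pickleK /= max_r.
Qed.

Lemma ratio_set_rmorph (F K : fieldType) (f : {rmorphism F -> K})
    (A : set nat) :
  f @` ratio_set F A `<=` ratio_set K A.
Proof.
move=> _ [_ [a [b [Aa Ab ->]]] <-]; exists a, b; split=> //.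
by rewrite fmorph_div !rmorph_nat.
Qed.

Lemma subset_dense (T : topologicalType) (A B : set T) :
  A `<=` B -> dense A -> dense B.
Proof.
move=> AB denseA U U_neq0 U_open.
by have [x [Ux /AB Bx]] := denseA U U_neq0 U_open; exists x.
Qed.

Lemma dense_ball (R : numDomainType) (T : pseudoMetricType R) (A : set T) :
  (forall (x : T) (e : R), 0 < e -> A `&` ball x e !=set0) -> dense A.
Proof.
move=> A_ball U [x Ux] U_open.
have /nbhs_ballP[e /= e_gt0 xeU] : nbhs x U by exact: open_nbhs_nbhs.
by have [y [Ay /xeU Uy]] := A_ball x e e_gt0; exists y.
Qed.

Lemma padic_absX (p : nat) (x : rat) (n : nat) :
  padic_abs p (x ^+ n) = padic_abs p x ^+ n.
Proof.
elim: n => [|n IHn]; first by rewrite !expr0 padic_abs1.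
by rewrite !exprS padic_absM IHn.
Qed.

Lemma padic_abs_prime (p : nat) : prime p -> padic_abs p p%:R = p%:R^-1.
Proof.
move=> p_pr; have p_neq0 : p%:Z != 0 by rewrite -lt0n prime_gt0.
have := padic_abs_frac p p_neq0 (oner_neq0 int).
by rewrite divr1 logn1 logn_prime // eqxx.
Qed.

Lemma padic_approx_ge (p : nat) (q b e : rat) : prime p -> 0 < e ->
  exists2 r : rat, b <= r & padic_abs p (q - r) < e.
Proof.
move=> p_pr e_gt0.
have expr_gt (x : rat) n : (Num.bound x <= n)%N -> x < p%:R ^+ n.
  move=> /upper_nthrootP/lt_le_trans; apply.
  by rewrite lerXn2r ?nnegrE // ler_nat prime_gt1.
pose n := maxn (Num.bound (b - q)) (Num.bound e^-1).
exists (q + p%:R ^+ n); first by rewrite -lerBlDl ltW ?expr_gt ?leq_maxl.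
rewrite opprD addNKr padic_absN padic_absX padic_abs_prime // exprVn.
by rewrite invf_plt ?posrE ?exprn_gt0 ?ltr0n ?prime_gt0 ?expr_gt ?leq_maxr.
Qed.

Lemma Qp_dist_ratr (p : nat) (q r : rat) :
  Qp_dist (ratr q : Qp p) (ratr r) = padic_abs p (q - r).
Proof. by rewrite /Qp_dist -Qp_abs_ratr -!rat_QpE rmorphB. Qed.

Lemma dense_rat_Qp_ge (p : nat) (b : rat) : prime p ->
  dense (rat_Qp p @` [set q | b <= q]).
Proof.
move=> p_pr; apply: dense_ball => x e e_gt0.
have e2_gt0 : 0 < e / 2 by rewrite divr_gt0.
have [q xq] := Qp_dense_rat x e2_gt0.
have [r r_ge qr] := padic_approx_ge q b p_pr e2_gt0.
exists (rat_Qp p r); split; first by exists r.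
rewrite ballEmdist /= rat_QpE (splitr e).
apply: le_lt_trans (Qp_dist_triangle (ratr q) _ _) (ltrD xq _).
by rewrite Qp_dist_ratr.
Qed.

Theorem theorem3p3 :
  exists A : set nat,
    [/\ A `<=` [set n | (0 < n)%N],
        ~ contains_AP A 3
      & forall p : nat, prime p -> dense (ratio_set (Qp p) A)].
Proof.
have [A [A_gt0 lacA ratA]] := @exists_lacunary_ratio_ge 2 isT.
exists A; split=> [//||p p_pr]; first exact: lacunary_AP_free.
apply: subset_dense (dense_rat_Qp_ge 2 p_pr) => _ [q /ratA Aq <-].
by apply: (ratio_set_rmorph (f := rat_Qp p)); exists q.
Qed.
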